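(* If $X$ is a block gluing $\mathbb{Z}^2$ subshift, $Y$ is a $\mathbb{Z}^2$ shift of finite type that satisfies single-site fillability and has a fixed point, and $h(X) > h(Y)$, then there exists a (topological) factor map from $X$ onto $Y$.
   Context: Distance in $\mathbb{Z}^2$ is the $\ell_\infty$ distance, and for $A,B\subset\mathbb{Z}^2$, $d(A,B)=\min_{a\in A,b\in B} d(a,b)$. $C_n=[0,n-1]^2$ (integer points). A pattern over a finite alphabet $\mathcal{A}$ is an element of $\mathcal{A}^S$ for some $S\subset\mathbb{Z}^2$ (its shape); patterns are considered up to translation. The shift action on $\mathcal{A}^{\mathbb{Z}^2}$ is $(\sigma_t x)(s)=x(s+t)$. A $\mathbb{Z}^2$ subshift is a subset of $\mathcal{A}^{\mathbb{Z}^2}$ ($\mathcal{A}$ finite) that is closed in the product of discrete topologies and invariant under all $\sigma_t$, $t\in\mathbb{Z}^2$. A shift of finite type (SFT) is a subshift consisting of all $x\in\mathcal{A}^{\mathbb{Z}^2}$ containing no pattern from some finite set $\mathcal{F}$ of finite patterns. $L(X)$ is the set of all patterns appearing in points of $X$, and $L_S(X)=L(X)\cap\mathcal{A}^S$. Topological entropy: $h(X)=\lim_{n\to\infty}\frac{1}{n^2}\log|L_{C_n}(X)|$. A fixed point of $Y$ is $y\in Y$ with $\sigma_t(y)=y$ for all $t\in\mathbb{Z}^2$. A factor map from $X$ onto $Y$ is a continuous surjection $\phi:X\to Y$ with $\phi\circ\sigma_t=\sigma_t\circ\phi$ for all $t$. A $\mathbb{Z}^2$ subshift $X$ is block gluing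 if there exists $g\ge 0$ such that for any rectangles $R,R'\subset\mathbb{Z}^2$ with $d(R,R')>g$ and any $w\in L_R(X)$, $w'\in L_{R'}(X)$, there exists $x\in X$ whose restrictions to $R$ and $R'$ are $w$ and $w'$ respectively. Single-site fillability is a condition on a $\mathbb{Z}^2$ SFT $Y$ over an alphabet $\mathcal{A}$ defined by a set of forbidden pairs of adjacent letters (i.e. a set of forbidden patterns on pairs of horizontally adjacent or vertically adjacent sites). It means that for any choice of letters $a,b,c,d\in\mathcal{A}$, there exists $e\in\mathcal{A}$ for which the pattern $\begin{smallmatrix} & a & \\ b & e & c\\ & d & \end{smallmatrix}$ (with $e$ at the center and $a,b,c,d$ above, left, right, below it respectively) contains none of the forbidden adjacent pairs. *)

(* Defs.v *)
From HB Require Import structures.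
From mathcomp Require Import all_boot all_order all_algebra finmap.
From mathcomp Require Import all_classical all_reals all_analysis.

Set Implicit Arguments.
Unset Strict Implicit.
Unset Printing Implicit Defensive.

Import Order.TTheory GRing.Theory Num.Theory.

Local Open Scope classical_set_scope.
Local Open Scope ring_scope.

Definition Z2 : Type := (int * int)%type.

HB.instance Definition _ := GRing.Zmodule.on Z2.

Definition linf_dist (a b : Z2) : nat :=
  maxn `|a.1 - b.1|%N `|a.2 - b.2|%N.

(* The minimum of the pairwise distances; it exists as soon as [S] and [T] are
   nonempty, and the value is 0 by default otherwise. *)
Definition set_dist (S T : set Z2) : nat :=
  let D := [set linf_dist a b | a in S & b in T] in
  xget 0%N [set m | D m /\ forall k, D k -> (m <= k)%N].

Definition box (p q : Z2) : set Z2 :=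
  [set s | (p.1 <= s.1 <= q.1) && (p.2 <= s.2 <= q.2)].

Definition is_rectangle (R : set Z2) : Prop :=
  exists p q : Z2, [/\ p.1 <= q.1, p.2 <= q.2 & R = box p q].

Definition csquare (n : nat) : set Z2 := box (0, 0) (n%:Z - 1, n%:Z - 1).

(* Configurations carry the product of the discrete topologies.  The alias
   [prod_topology] matters: a bare function type would carry the topology of
   uniform convergence. *)
Definition config (A : finType) : Type :=
  prod_topology (fun _ : Z2 => discrete_topology A).

HB.instance Definition _ (A : finType) := Topological.on (config A).

(* A pattern of shape [S] is encoded as a partial function on Z^2 with domain
   exactly [S]. *)
Definition pattern (A : finType) : Type := Z2 -> option A.

HB.instance Definition _ (A : finType) := Choice.on (pattern A).

Section Shifts.
Variable A : finType.
Implicit Types (x : config A) (w : pattern A) (X : set (config A)).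

Definition sigma (t : Z2) x : config A := fun s => x (s + t).

Definition pshape w : set Z2 := [set s | w s != None].

Definition restrict x (S : set Z2) : pattern A :=
  fun s => if s \in S then Some (x s) else None.

(* Patterns are considered up to translation, so [w] may appear anywhere. *)
Definition appears w x : Prop :=
  exists t : Z2, restrict (sigma t x) (pshape w) = w.

Definition is_subshift X : Prop :=
  closed X /\ forall t x, X x -> X (sigma t x).

Definition is_sft X : Prop :=
  is_subshift X /\
  exists F : set (pattern A),
    [/\ finite_set F, forall w, F w -> finite_set (pshape w)
      & X = [set x | forall w, F w -> ~ appears w x]].

Definition language X : set (pattern A) :=
  [set w | exists2 x, X x & appears w x].

Definition language_on (S : set Z2) X : set (pattern A) :=
  language X `&` [set w | pshape w = S].

Definition block_gluing X : Prop :=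
  exists g : nat, forall R R' : set Z2,
    is_rectangle R -> is_rectangle R' -> (g < set_dist R R')%N ->
    forall w w' : pattern A, language_on R X w -> language_on R' X w' ->
    exists x, [/\ X x, restrict x R = w & restrict x R' = w'].

Definition is_fixed_point X x : Prop := X x /\ forall t, sigma t x = x.

(* [H a b]: [a] immediately to the left of [b] is forbidden;
   [V a b]: [a] immediately below [b] is forbidden. *)
Definition adjacency_shift (H V : rel A) : set (config A) :=
  [set x | forall s, ~~ H (x s) (x (s + (1, 0))) /\
                     ~~ V (x s) (x (s + (0, 1)))].

Definition single_site_fillable X : Prop :=
  exists H V : rel A, X = adjacency_shift H V /\
    forall a b c d : A, exists e : A,
      [/\ ~~ V e a, ~~ H b e, ~~ H e c & ~~ V d e].

End Shifts.

(* The logarithm is extended by [lne 0 = -oo], so the empty subshift has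
   entropy -oo. *)
Definition entropy (R : realType) (A : finType) (X : set (config A)) : \bar R :=
  limn (fun n : nat =>
    (((n ^ 2)%N%:R : R)^-1%:E *
     lne ((#|` fset_set (language_on (csquare n) X)|%fset)%:R : R)%:E)%E).

Definition is_factor_map (A B : finType)
    (X : set (config A)) (Y : set (config B)) (phi : config A -> config B) :
    Prop :=
  [/\ {within X, continuous phi},
      phi @` X = Y
    & forall t x, X x -> phi (sigma t x) = sigma t (phi x)].

(* Main.v *)
Require Import Defs.
From mathcomp Require Import all_boot all_order all_algebra finmap.
From mathcomp Require Import zify ring lra.
From mathcomp Require Import all_classical all_reals all_analysis.

Set Implicit Arguments.
Unset Strict Implicit.
Unset Printing Implicit Defensive.

Import Order.TTheory GRing.Theory Num.Theory.
Import numFieldNormedType.Exports.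

Local Open Scope classical_set_scope.
Local Open Scope ring_scope.

(** The factor map reads data of [Y] off blocks that are announced by a marker.

    Write [g] for the gluing gap and [N0 = n + g].  Gluing one cell at a time
    within a row, then the rows, then passing to a limit by compactness, puts
    arbitrary [n]-by-[n] patterns of [X] on the cells of the lattice [N0 Z^2]
    ([glue_grid]).

    Marker.  Since [X] has two points, gluing them at a multiple of [t] shows that no
    [t <> 0] is a period of the whole of [X] ([no_common_period]); gluing
    together one witness for each [t] with [|t| < N0] gives a point [m] of [X]
    whose restriction to a square of side [F], polynomial in [N0], disagrees
    with all its translates by such [t] ([self_conflicting_point]).

    Data.  The data letters are the [n]-patterns of [X] that do not occur in [m]
    in a square slightly larger than the marker.  Only polynomially many are thrown away, so the
    entropy gap lets one choose [n] with more data letters than [N0]-patterns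
    of [Y] ([entropy_gap], [card_data_letters]).  A block of side [N = J L N0]
    consists of one marker and of data cells; for [J] large its data cells
    have enough fillings to encode every [N]-pattern of [Y], although the
    marker occupies [L^2] of the [(J L)^2] cells ([block_coding_exists]).

    Uniqueness of parsing.  Fill the lattice with encoded blocks.  A window of
    the size of the marker that is not within [N0] of a marker position contains
    a whole data cell ([locate_window]), which is no subpattern of the marker;
    within [N0] of one, the self-conflict applies.  So the marker occurs at the
    points of [N Z^2] only ([encoded_point]).

    The map.  In an arbitrary [x], keep the occurrences of the marker that are
    isolated at scale [N]; the blocks they start are disjoint.  Write the
    decoded pattern on each block and the letter of the fixed point elsewhere.
    This may break the rules of [Y], but every violation involves a site of a
    block.  Go through the [N^2] positions of a block one after the other, and
    at each of them simultaneously re-choose, in all blocks, the letter at this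
    position if it clashes with a neighbour; single-site fillability provides
    the new letter, and no two sites treated simultaneously are adjacent.  Every
    edge that was repaired stays repaired, so the result lies in [Y]
    ([block_code_valid]), whereas nothing is changed when the first guess is in
    [Y] already ([block_code_tentative]), as happens for the encoded points.
    Hence the map is onto; it is a sliding block code by construction. *)

(** * Points of full shifts: limits and continuity *)

Lemma nbhs_agree (A : finType) (s : Z2) (p : config A) :
  nbhs p [set q : config A | q s = p s].
Proof.
have h := @proj_continuous Z2 (fun=> discrete_topology A) s p.
exact: (h _ (@discrete_set1 (discrete_topology A) (p s))).
Qed.

(** Compactness of the full shift, in the form used to pass from finite to
    infinite gluings. *)
Lemma closed_config_limit (A : finType) (X : set (config A)) (z : nat -> config A) :
  closed X -> (forall m, X (z m)) ->
  exists2 p, X p & forall s b m0, (forall m, (m0 <= m)%N -> z m s = b) -> p s = b.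
Proof.
move=> Xcl zX.
have Xco : compact X.
  apply: (@subclosed_compact (config A) X [set f | forall s, [set: discrete_topology A] (f s)]) => //.
  apply: (@tychonoff Z2 (fun=> discrete_topology A) (fun=> setT)) => s.
  apply: finite_compact; exact: (@finite_finset A).
have PF : ProperFilter (z @ \oo) by exact: fmap_proper_filter.
have [|p [Xp clp]] := Xco (z @ \oo) PF; first by exists 0%N => // m _; exact: zX.
exists p => // s b m0 zb.
have [|q [+ <-]] := clp [set q | q s = b] _ _ (nbhs_agree s p) => //.
by exists m0.
Qed.

Section ProductTopology.
Import ArrowAsProduct.
Lemma cvg_pointwise (I : eqType) (K : I -> topologicalType)
    (F : set_system (prod_topology K)) (f : prod_topology K) :
  Filter F -> (forall i, (@proj I K i) @ F --> f i) -> F --> f.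
Proof.
move=> FF h; apply/cvg_sup => i.
have surj : @proj I K i @` setT = setT.
  rewrite eqEsubset; split => y //= _; exists (dfwith f i y) => //.
  by rewrite /proj dfwithin.
apply/cvg_image => //.
move=> U fU; exists (@proj I K i @^-1` U); first exact: (h i).
by rewrite image_preimage.
Qed.
End ProductTopology.

Lemma continuous_pointwise (A B : finType) (phi : config A -> config B) :
  (forall x s, nbhs x [set x' | phi x' s = phi x s]) -> continuous phi.
Proof.
move=> h x.
have FF := @fmap_filter _ _ phi (nbhs x) (nbhs_filter x).
pose K := fun _ : Z2 => (discrete_topology B : topologicalType).
have H1 : forall s, (@proj Z2 K s) @ (nbhs (phi @ (nbhs x))) --> (phi x s : K s).
  move=> s U.
  move=> /(@nbhs_singleton (discrete_topology B)) /= Us.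
  apply: filterS (h x s) => x' /= ex.
  rewrite /preimage /= /proj ex.
  exact: Us.
exact: (@cvg_pointwise Z2 K (phi @ nbhs x) (phi x) FF H1).
Qed.

(** * Gluing patterns on a grid of cells *)

Lemma linf_distP (a b : Z2) (m : nat) :
  (m < linf_dist a b)%N =
  [|| a.1 + m%:Z < b.1, b.1 + m%:Z < a.1, a.2 + m%:Z < b.2 | b.2 + m%:Z < a.2].
Proof. rewrite /linf_dist; lia. Qed.

Lemma set_dist_gt (S T : set Z2) (m : nat) a0 b0 : S a0 -> T b0 ->
  (forall a b, S a -> T b -> (m < linf_dist a b)%N) -> (m < set_dist S T)%N.
Proof.
move=> Sa0 Tb0 h; rewrite /set_dist.
set D := [set linf_dist a b | a in S & b in T].
set P := [set k | _].
have [k Pk] : P !=set0.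
  pose Db k := `[< D k >].
  have exD : exists k, Db k.
    by exists (linf_dist a0 b0); apply/asboolP; exists a0 => //; exists b0.
  case: (ex_minnP exD) => k /asboolP Dk kmin.
  by exists k; split => // k' Dk'; apply/kmin/asboolP.
have := xgetI 0%N Pk.
by case=> -[a Sa [b Tb <-]] _; apply: h.
Qed.

(** Block gluing with an explicit gap, which fixes the size of all later
    cells. *)
Definition gluing_gap (A : finType) (X : set (config A)) (g : nat) : Prop :=
  forall R R' : set Z2,
    is_rectangle R -> is_rectangle R' -> (g < set_dist R R')%N ->
    forall w w' : pattern A, language_on R X w -> language_on R' X w' ->
    exists x, [/\ X x, Defs.restrict x R = w & Defs.restrict x R' = w'].

Section Gluing.
Variables (A : finType) (X : set (config A)) (g : nat).
Hypothesis Xsub : is_subshift X.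
Hypothesis Xgl : gluing_gap X g.

Lemma restrict_language (R : set Z2) x : X x -> language_on R X (Defs.restrict x R).
Proof.
move=> Xx; have sh : pshape (Defs.restrict x R) = R.
  apply/seteqP; split => s; rewrite /pshape /= /Defs.restrict.
    by case: ifPn => // /set_mem.
  by move=> /mem_set ->.
split => //; exists x => //; exists 0; rewrite sh; congr (Defs.restrict _ _).
by apply/funext => s; rewrite /sigma addr0.
Qed.

(** Block gluing in terms of points instead of patterns. *)
Lemma glue2 (R R' : set Z2) x x' : is_rectangle R -> is_rectangle R' ->
  (g < set_dist R R')%N -> X x -> X x' ->
  exists z, [/\ X z, forall s, R s -> z s = x s & forall s, R' s -> z s = x' s].
Proof.
move=> hR hR' d Xx Xx'.
have [z [Xz e e']] := Xgl hR hR' d (restrict_language _ Xx) (restrict_language _ Xx').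
have ag (Q : set Z2) (y : config A) s : Defs.restrict z Q = Defs.restrict y Q -> Q s -> z s = y s.
  by move=> eQ Qs; have := congr1 (@^~ s) eQ; rewrite /Defs.restrict (mem_set Qs) => -[].
by exists z; split => // s; [exact: ag e|exact: ag e'].
Qed.

(** Block gluing only joins two rectangles, so many targets [T i] are joined in
    an order where the part already built is covered by a rectangle [H i]
    at distance more than [g] from the next target. *)
Lemma glue_chain (T H : nat -> set Z2) (xi : nat -> config A) :
  (forall i, is_rectangle (T i)) -> (forall i, is_rectangle (H i)) ->
  (forall i, X (xi i)) ->
  T 0%N `<=` H 0%N -> (forall i, H i `<=` H i.+1) -> (forall i, T i.+1 `<=` H i.+1) ->
  (forall i, (g < set_dist (H i) (T i.+1))%N) ->
  forall m, exists2 z, X z & forall i s, (i <= m)%N -> T i s -> z s = xi i s.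
Proof.
move=> rT rH Xxi T0 Hs Ts d.
have TH j : T j `<=` H j by case: j.
have TH' i m : (i <= m)%N -> T i `<=` H m.
  elim: m => [|m IH]; first by rewrite leqn0 => /eqP ->.
  by rewrite leq_eqVlt => /orP[/eqP -> //|/IH h s /h]; exact: Hs.
elim=> [|m [z Xz zi]].
  by exists (xi 0%N) => // i s; rewrite leqn0 => /eqP ->.
have [z' [Xz' z'H z'T]] := glue2 (rH m) (rT m.+1) (d m) Xz (Xxi m.+1).
exists z' => // i s; rewrite leq_eqVlt => /orP[/eqP -> /z'T //|].
by rewrite ltnS => im Tis; rewrite z'H; [exact: zi|exact: (@TH' i m im s Tis)].
Qed.

(** One row of cells or, when [swap] holds, one column of strips: the two
    directions of a grid are handled by the same chain. *)
Lemma glue_strips (swap : bool) (n : nat) (a c d : int) (xi : nat -> config A) (m : nat) :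
  let u (s : Z2) := if swap then s.2 else s.1 in
  let v (s : Z2) := if swap then s.1 else s.2 in
  (0 < n)%N -> c <= d -> (forall i, X (xi i)) ->
  exists2 z, X z & forall (i : nat) (s : Z2), (i <= m)%N ->
    a + i%:Z * (n + g)%N%:Z <= u s < a + i%:Z * (n + g)%N%:Z + n%:Z ->
    c <= v s <= d -> z s = xi i s.
Proof.
move=> u v n0 cd Xxi.
pose b (i : nat) := a + i%:Z * (n + g)%N%:Z.
have bS i : b i.+1 = b i + (n + g)%N%:Z by rewrite /b; ring.
have ab i : a <= b i by rewrite /b; nia.
pose K lo hi := [set s : Z2 | (lo <= u s <= hi) && (c <= v s <= d)].
have rectK lo hi : lo <= hi -> is_rectangle (K lo hi).
  move=> lh; rewrite /K /u /v; case: (swap); last by exists (lo, c), (hi, d).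
  by exists (c, lo), (d, hi); split => //; apply/seteqP; split => s /=; rewrite andbC.
pose T i := K (b i) (b i + n%:Z - 1).
pose H i := K a (b i + n%:Z - 1).
have [i|i|//||i|i|i|z Xz zi] := @glue_chain T H xi _ _ _ _ _ _ _ m.
- by apply: rectK; lia.
- by apply: rectK; have := ab i; lia.
- by move=> s; rewrite /T /H /K /= /b; lia.
- by move=> s; rewrite /H /K /= bS; lia.
- by move=> s; rewrite /T /H /K /=; have := ab i.+1; lia.
- apply: (@set_dist_gt _ _ _ (if swap then (c, a) else (a, c))
    (if swap then (c, b i.+1) else (b i.+1, c))); rewrite /H /T /K /u /v;
    have := ab i; have := bS i; move: (b i) (b i.+1) => bi bi' e abi.
  + by case: (swap) => /=; lia.
  + by case: (swap) => /=; lia.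
  + by move=> s t /=; rewrite linf_distP e; case: (swap); lia.
exists z => // i s im h1 h2; apply: zi => //.
by move: h1; rewrite /T /K /= -/(b i); move: (b i) => bi; lia.
Qed.

(** Cells of side [n] on the lattice of spacing [k], indexed by [c]; a spacing of
    [n + g] leaves just enough room for the gluing gap. *)
Definition in_cell (n k : nat) (c s : Z2) : bool :=
  (c.1 * k%:Z <= s.1 < c.1 * k%:Z + n%:Z) && (c.2 * k%:Z <= s.2 < c.2 * k%:Z + n%:Z).

Lemma glue_grid (n : nat) (xi : Z2 -> config A) :
  (0 < n)%N -> (forall c, X (xi c)) ->
  exists2 z, X z & forall c s : Z2, in_cell n (n + g) c s -> z s = xi c s.
Proof.
move=> n0 Xxi.
suff fin (m : nat) : exists z, X z /\ forall c s : Z2,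
    - m%:Z <= c.1 <= m%:Z -> - m%:Z <= c.2 <= m%:Z ->
    in_cell n (n + g) c s -> z s = xi c s.
  have [z zP] := choice fin.
  have [p Xp pP] := @closed_config_limit A X z Xsub.1 (fun m => (zP m).1).
  exists p => // c s cs; apply: (pP s (xi c s) (absz c.1 + absz c.2)%N) => m hm.
  by apply: (zP m).2 => //; lia.
set N := (n + g)%N.
pose ix (i : nat) : int := i%:Z - m%:Z.
pose lo : int := - m%:Z * N%:Z.
pose hi : int := (m%:Z + 1) * N%:Z.
have lohi : lo <= hi by rewrite /lo /hi; nia.
have row j : exists z, X z /\ forall (i : nat) (s : Z2), (i <= m.*2)%N ->
    lo + i%:Z * N%:Z <= s.1 < lo + i%:Z * N%:Z + n%:Z -> lo <= s.2 <= hi ->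
    z s = xi (ix i, ix j) s.
  have [z Xz zP] := @glue_strips false n lo lo hi (fun i => xi (ix i, ix j)) m.*2 n0 lohi (fun i => Xxi _).
  by exists z.
have [zr zrP] := choice row.
have [z Xz zP] := @glue_strips true n lo lo hi zr m.*2 n0 lohi (fun i => (zrP i).1).
exists z; split => // -[c1 c2] [s1 s2] /= h1 h2 /andP[/= cs1 cs2].
pose i := absz (c1 + m%:Z)%R; pose j := absz (c2 + m%:Z)%R.
have ic : c1 = ix i by rewrite /ix /i; lia.
have jc : c2 = ix j by rewrite /ix /j; lia.
have il : (i <= m.*2)%N by rewrite /i; lia.
have jl : (j <= m.*2)%N by rewrite /j; lia.
have ei : lo + i%:Z * N%:Z = c1 * N%:Z by rewrite /lo ic /ix; ring.
have ej : lo + j%:Z * N%:Z = c2 * N%:Z by rewrite /lo jc /ix; ring.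
have nN : (n <= N)%N by rewrite /N leq_addr.
rewrite (zP j (s1, s2) jl) /=; last 2 first.
- by rewrite ej.
- by rewrite /lo /hi; nia.
rewrite ((zrP j).2 i (s1, s2) il) /= ?ei -?ic -?jc //.
by rewrite /lo /hi; nia.
Qed.

End Gluing.

(** * Sliding block codes and the repair of local violations *)

Section FiniteDependence.
Variable A : finType.

Definition finitely_determined (T : Type) (F : config A -> T) : Prop :=
  exists l : seq Z2, forall x x', {in l, forall u, x u = x' u} -> F x = F x'.

Lemma fd_comp (T U : Type) (F : config A -> T) (h : T -> U) :
  finitely_determined F -> finitely_determined (fun x => h (F x)).
Proof. by move=> [l lP]; exists l => x x' /lP ->. Qed.

Lemma fd_pair (T U : Type) (F : config A -> T) (G : config A -> U) :
  finitely_determined F -> finitely_determined G ->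
  finitely_determined (fun x => (F x, G x)).
Proof.
move=> [l lP] [k kP]; exists (l ++ k) => x x' h.
by rewrite (lP x x') ?(kP x x') // => u ul; apply: h; rewrite mem_cat ul ?orbT.
Qed.

Lemma fd_family (I : finType) (T : Type) (F : I -> config A -> T) :
  (forall i, finitely_determined (F i)) ->
  finitely_determined (fun x i => F i x).
Proof.
move=> /choice[l lP]; exists (flatten [seq l i | i <- enum I]) => x x' h.
apply/funext => i; apply: lP => u ul; apply: h.
by apply/flattenP; exists (l i) => //; apply: map_f; rewrite mem_enum.
Qed.

Lemma fd_site (s : Z2) : finitely_determined (fun x : config A => x s).
Proof. by exists [:: s] => x x' h; apply: h; rewrite inE. Qed.

Lemma fd_continuous (B : finType) (phi : config A -> config B) :
  (forall s, finitely_determined (fun x => phi x s)) -> continuous phi.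
Proof.
move=> h; apply: continuous_pointwise => x s; have [l lP] := h s.
suff : nbhs x [set x' : config A | {in l, forall u, x' u = x u}].
  by apply: filterS => x' /= e; exact: lP.
elim: l {lP} => [|u l IH]; first by apply: filterS filterT.
apply: filterS (filterI (nbhs_agree u x) IH) => x' /= [e1 e2] v.
by rewrite inE => /orP[/eqP ->//|]; exact: e2.
Qed.

End FiniteDependence.

Section Refill.
Variables (B : finType) (H V : rel B).
Hypothesis fillable : forall a b c d : B, exists e : B,
      [/\ ~~ V e a, ~~ H b e, ~~ H e c & ~~ V d e].

Definition fits (a b c d e : B) : bool :=
  [&& ~~ V e a, ~~ H b e, ~~ H e c & ~~ V d e].

Definition fill (a b c d e : B) : B :=
  if fits a b c d e then e else odflt e [pick e' | fits a b c d e'].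

Lemma fill_fits a b c d e : fits a b c d (fill a b c d e).
Proof.
rewrite /fill; case: ifPn => // _; case: pickP => [//|none].
by have [e' [h1 h2 h3 h4]] := fillable a b c d; have := none e'; rewrite /fits h1 h2 h3 h4.
Qed.

Lemma fill_id a b c d e : fits a b c d e -> fill a b c d e = e.
Proof. by rewrite /fill => ->. Qed.

Local Notation e1 := ((1, 0) : Z2).
Local Notation e2 := ((0, 1) : Z2).

Definition refill (D : Z2 -> bool) (z : config B) : config B := fun s =>
  if D s then fill (z (s + e2)) (z (s - e1)) (z (s + e1)) (z (s - e2)) (z s)
  else z s.

Definition okH (z : config B) (s : Z2) := ~~ H (z s) (z (s + e1)).
Definition okV (z : config B) (s : Z2) := ~~ V (z s) (z (s + e2)).

Definition independent (D : Z2 -> bool) :=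
  forall s, D s -> ~~ D (s + e1) && ~~ D (s + e2).

(** Re-choosing letters on an independent set repairs the edges that meet the set
    and does not touch the others. *)
Lemma refill_okH D z s : independent D -> [|| D s, D (s + e1) | okH z s] ->
  okH (refill D z) s.
Proof.
move=> iD; rewrite /okH /refill; have [Ds|nDs] := boolP (D s).
  have /andP[/negbTE -> _] := iD _ Ds.
  by have /and4P[_ _ h _] := fill_fits (z (s + e2)) (z (s - e1)) (z (s + e1)) (z (s - e2)) (z s).
case: ifPn => //= Ds1 _; rewrite addrK.
by have /and4P[_ h _ _] := fill_fits (z (s + e1 + e2)) (z s) (z (s + e1 + e1)) (z (s + e1 - e2)) (z (s + e1)).
Qed.

Lemma refill_okV D z s : independent D -> [|| D s, D (s + e2) | okV z s] ->
  okV (refill D z) s.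
Proof.
move=> iD; rewrite /okV /refill; have [Ds|nDs] := boolP (D s).
  have /andP[_ /negbTE ->] := iD _ Ds.
  by have /and4P[h _ _ _] := fill_fits (z (s + e2)) (z (s - e1)) (z (s + e1)) (z (s - e2)) (z s).
case: ifPn => //= Ds1 _; rewrite addrK.
by have /and4P[_ _ _ h] := fill_fits (z (s + e2 + e2)) (z (s + e2 - e1)) (z (s + e2 + e1)) (z s) (z (s + e2)).
Qed.

Lemma refill_id D z : (forall s, okH z s && okV z s) -> refill D z = z.
Proof.
move=> h; apply/funext => s; rewrite /refill; case: ifPn => // _; apply: fill_id.
have /andP[hh hv] := h s; have /andP[hh' _] := h (s - e1); have /andP[_ hv'] := h (s - e2).
by move: hh hv hh' hv'; rewrite /okH /okV /fits !subrK => -> -> -> ->.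
Qed.

Variables (I : eqType) (D : I -> Z2 -> bool).
Hypothesis indepD : forall i, independent (D i).

Definition refills (l : seq I) (z : config B) : config B :=
  foldl (fun z i => refill (D i) z) z l.

(** A repaired edge survives the later rounds, so only one round per edge
    matters. *)
Lemma refills_okH l z s :
  has (fun i => D i s || D i (s + e1)) l || okH z s -> okH (refills l z) s.
Proof.
elim: l z => [//|i l IH] z /= h; apply: IH.
have [//|nh /=] := boolP (has _ l); apply: refill_okH => //.
by move: h; rewrite (negbTE nh) orbF orbA.
Qed.

Lemma refills_okV l z s :
  has (fun i => D i s || D i (s + e2)) l || okV z s -> okV (refills l z) s.
Proof.
elim: l z => [//|i l IH] z /= h; apply: IH.
have [//|nh /=] := boolP (has _ l); apply: refill_okV => //.
by move: h; rewrite (negbTE nh) orbF orbA.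
Qed.

Lemma refills_id l z : (forall s, okH z s && okV z s) -> refills l z = z.
Proof. by move=> h; elim: l => [//|i l IH] /=; rewrite refill_id. Qed.

End Refill.

Definition offset (N : nat) (o : 'I_N * 'I_N) : Z2 := (o.1%:Z, o.2%:Z).

Section BlockCode.
Variables (A B : finType) (H V : rel B) (b0 : B) (N : nat).
Variable M : config A -> Z2 -> bool.
Hypothesis Msep : forall x s t, M x s -> M x t ->
  `|s.1 - t.1| < N%:Z -> `|s.2 - t.2| < N%:Z -> s = t.
Variable blk : config A -> Z2 -> ('I_N * 'I_N) -> B.

(** First guess at the image: a block letter at position [o] of the block started
    by a marker, and [b0] off the blocks. *)
Definition tentative (x : config A) : config B := fun s =>
  if [pick o | M x (s - offset o)] is Some o then blk x (s - offset o) o else b0.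

(** Separated markers start disjoint blocks, so the [pick] has no choice. *)
Lemma tentative_in x s o : M x s -> tentative x (s + offset o) = blk x s o.
Proof.
move=> Ms; rewrite /tentative; case: pickP => [q Mq|/(_ o)]; last by rewrite addrK Ms.
have e : s = s + offset o - offset q.
  apply: (Msep Ms Mq) => /=; move: o q {Mq} => [ [i1 h1] [i2 h2] ] [ [i3 h3] [i4 h4] ] /=; lia.
rewrite -e; congr blk.
move: e; rewrite -addrA => /(congr1 (fun v : Z2 => - s + v)); rewrite addNr addKr.
move: o q {Mq} => [ [i1 h1] [i2 h2] ] [ [i3 h3] [i4 h4] ] [/= e e'].
by congr pair; apply: val_inj => /=; lia.
Qed.

(** The rounds are indexed by positions in a block, an order that a shift of the
    configuration preserves. *)
Definition block_code (x : config A) : config B :=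
  refills H V (fun (o : 'I_N * 'I_N) s => M x (s - offset o)) (enum {: 'I_N * 'I_N}) (tentative x).

Hypothesis fillable : forall a b c d : B, exists e : B,
      [/\ ~~ V e a, ~~ H b e, ~~ H e c & ~~ V d e].
Hypothesis b0H : ~~ H b0 b0.
Hypothesis b0V : ~~ V b0 b0.
Hypothesis N2 : (1 < N)%N.
Hypothesis MS : forall x t s, M (sigma t x) s = M x (s + t).
Hypothesis Mfd : forall s, finitely_determined (M^~ s).
Hypothesis blkS : forall x t s o, blk (sigma t x) s o = blk x (s + t) o.
Hypothesis blkfd : forall s o, finitely_determined (fun x => blk x s o).

Lemma marker_unit_sep x u e : M x u -> (e = (1, 0) \/ e = (0, 1)) -> ~~ M x (u + e).
Proof.
move=> Mu he; apply/negP => Mu'.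
have : u = u + e.
  by apply: (Msep Mu Mu'); case: he => [->|->]; rewrite /=; lia.
move=> /(congr1 (fun v : Z2 => - u + v)); rewrite addKr addNr; move=> e0.
by case: he => E; rewrite E in e0; move/eqP: e0.
Qed.

(** Adjacent sites at the same position of their blocks would come from adjacent
    markers. *)
Lemma offset_independent x (o : 'I_N * 'I_N) : independent (fun s => M x (s - offset o)).
Proof.
move=> s Ms; rewrite !(addrAC s _ (- _)).
by rewrite !marker_unit_sep //; [right|left].
Qed.

(** An edge off all blocks joins two copies of [b0], which is allowed because
    [b0] is the letter of a fixed point. *)
Lemma block_code_valid x : adjacency_shift H V (block_code x).
Proof.
move=> s; split.
  apply: (refills_okH fillable (@offset_independent x)).
  have [//|/hasPn none /=] := boolP (has _ _).
  rewrite /okH /tentative; case: pickP => [q Mo|_].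
    by have := none q; rewrite mem_enum Mo => /(_ isT).
  case: pickP => [q Mo|_ //].
  by have := none q; rewrite mem_enum Mo orbT => /(_ isT).
apply: (refills_okV fillable (@offset_independent x)).
have [//|/hasPn none /=] := boolP (has _ _).
rewrite /okV /tentative; case: pickP => [q Mo|_].
  by have := none q; rewrite mem_enum Mo => /(_ isT).
case: pickP => [q Mo|_ //].
by have := none q; rewrite mem_enum Mo orbT => /(_ isT).
Qed.

Lemma block_code_tentative x : adjacency_shift H V (tentative x) ->
  block_code x = tentative x.
Proof.
by move=> h; apply: refills_id => s; have [h1 h2] := h s; apply/andP.
Qed.

Lemma refills_sigma (I : eqType) (D : I -> Z2 -> bool) l z t :
  refills H V (fun i s => D i (s + t)) l (sigma t z) =
  sigma t (refills H V D l z).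
Proof.
elim: l z => [//|i l IH] z /=; rewrite -IH; congr refills.
by apply/funext => s; rewrite /refill /sigma !(addrAC _ t).
Qed.

Lemma block_code_sigma x t : block_code (sigma t x) = sigma t (block_code x).
Proof.
rewrite /block_code -refills_sigma.
have -> : tentative (sigma t x) = sigma t (tentative x).
  apply/funext => s; rewrite /sigma /tentative.
  have E (o : 'I_N * 'I_N) : M (sigma t x) (s - offset o) = M x (s + t - offset o).
    by rewrite MS addrAC.
  rewrite (eq_pick E); case: pickP => // q _.
  by rewrite blkS addrAC.
congr (refills H V _ _ _); apply/funext => o; apply/funext => s.
by rewrite MS addrAC.
Qed.

Lemma block_code_fd s : finitely_determined (fun x => block_code x s).
Proof.
rewrite /block_code; set l := enum _.
suff gen (z : config A -> config B) : (forall s, finitely_determined (z^~ s)) ->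
    forall s, finitely_determined (fun x =>
      refills H V (fun (o : 'I_N * 'I_N) s => M x (s - offset o)) l (z x) s).
  apply: gen => {}s.
  have f1 := @fd_family A _ _ (fun (o : 'I_N * 'I_N) x => M x (s - offset o)) (fun o => Mfd _).
  have f2 := @fd_family A _ _ (fun (o : 'I_N * 'I_N) x => blk x (s - offset o) o) (fun o => blkfd _ _).
  exact: (@fd_comp _ _ _ _ (fun p => if [pick o | p.1 o] is Some o then p.2 o else b0) (fd_pair f1 f2)).
elim: l z => [//|o l IH] z zfd; apply: (IH (fun x => refill H V (fun s => M x (s - offset o)) (z x))).
move=> {}s.
have fM := Mfd (s - offset o).
have f := fd_pair fM (fd_pair (fd_pair (zfd (s + (0, 1))) (zfd (s - (1, 0))))
  (fd_pair (fd_pair (zfd (s + (1, 0))) (zfd (s - (0, 1)))) (zfd s))).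
exact: (@fd_comp _ _ _ _ (fun p => if p.1 then
  fill H V p.2.1.1 p.2.1.2 p.2.2.1.1 p.2.2.1.2 p.2.2.2 else p.2.2.2) f).
Qed.

End BlockCode.

(** * Counting patterns *)

Definition read (A : finType) (n : nat) (x : config A) (t : Z2) :
  {ffun 'I_n * 'I_n -> A} := [ffun o => x (t + offset o)].

Definition lang (A : finType) (X : set (config A)) (n : nat) :
    {set {ffun 'I_n * 'I_n -> A}} :=
  [set p | `[< exists2 x, X x & read n x 0 = p >]]%SET.

Lemma offset_inj n : injective (@offset n).
Proof.
move=> [ [i1 h1] [i2 h2] ] [ [i3 h3] [i4 h4] ] [/= e e'].
by congr pair; apply: val_inj => /=; lia.
Qed.

Lemma csquare_offset n (s : Z2) : csquare n s <-> exists o : 'I_n * 'I_n, s = offset o.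
Proof.
case: s => s1 s2; rewrite /csquare /box /=; split.
  move=> h; have h1 : (absz s1 < n)%N by lia.
  have h2 : (absz s2 < n)%N by lia.
  by exists (Ordinal h1, Ordinal h2); rewrite /offset /=; congr pair; lia.
by move=> [ [ [i1 h1] [i2 h2] ] [/= -> ->] ]; lia.
Qed.

Section Language.
Variables (A : finType) (X : set (config A)).
Hypothesis XS : forall t x, X x -> X (sigma t x).

Lemma read_sigma n (x : config A) t s : read n (sigma t x) s = read n x (s + t).
Proof. by apply/ffunP => o; rewrite !ffunE /sigma addrAC. Qed.

Lemma read_lang n x t : X x -> read n x t \in lang X n.
Proof.
move=> Xx; rewrite inE; apply/asboolP; exists (sigma t x); first exact: XS.
by rewrite read_sigma add0r.
Qed.

Lemma langP n p : p \in lang X n -> exists2 x, X x & read n x 0 = p.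
Proof. by rewrite inE => /asboolP. Qed.

(** Patterns of square shape as finite functions: this places the counts of the
    entropy in a finite type. *)
Definition pattern_of n (p : {ffun 'I_n * 'I_n -> A}) : pattern A :=
  fun s => if [pick o | offset o == s] is Some o then Some (p o) else None.

Lemma pattern_of_offset n (p : {ffun 'I_n * 'I_n -> A}) o :
  pattern_of p (offset o) = Some (p o).
Proof.
rewrite /pattern_of; case: pickP => [q /eqP/offset_inj -> //|/(_ o)].
by rewrite eqxx.
Qed.

Lemma pattern_of_inj n : injective (@pattern_of n).
Proof.
move=> p q e; apply/ffunP => o; have := pattern_of_offset p o.
by rewrite e pattern_of_offset => -[].
Qed.

Lemma pattern_of_read n (x : config A) : pattern_of (read n x 0) = Defs.restrict x (csquare n).
Proof.
apply/funext => s; rewrite /Defs.restrict; case: ifPn => [/set_mem/csquare_offset[q ->]|/negP ns].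
  by rewrite pattern_of_offset ffunE add0r.
rewrite /pattern_of; case: pickP => // q /eqP e.
by case: ns; apply/mem_set/csquare_offset; exists q.
Qed.

Lemma card_language_on n :
  #|` fset_set (language_on (csquare n) X)|%fset = #|lang X n|.
Proof.
have -> : language_on (csquare n) X = [set pattern_of p | p in [set` lang X n]].
  apply/seteqP; split => [w [[x Xx [t tw]] sw]|w [p /= /langP[x Xx <-] <-]].
    rewrite /= in sw.
    have <- : pattern_of (read n x t) = w.
      by rewrite -tw sw -pattern_of_read read_sigma add0r.
    by apply: imageP; exact: read_lang.
  by rewrite pattern_of_read; exact: restrict_language.
rewrite fset_set_image; last exact: finite_finpred.
rewrite card_imfset; last exact: pattern_of_inj.
rewrite cardE; apply/perm_size/uniq_perm.
- exact: enum_finmem_uniq.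
- exact: enum_uniq.
- move=> p; rewrite mem_enum enum_finmemE /= in_fset_set; last exact: finite_finpred.
  by apply/idP/idP => [/set_mem|/mem_set].
Qed.

Lemma lang_gt0 n x : X x -> (0 < #|lang X n|)%N.
Proof. by move=> Xx; apply/card_gt0P; exists (read n x 0); exact: read_lang. Qed.

Lemma lang_mono m n : (m <= n)%N -> (#|lang X m| <= #|lang X n|)%N.
Proof.
move=> mn.
pose r (p : {ffun 'I_n * 'I_n -> A}) : {ffun 'I_m * 'I_m -> A} :=
  [ffun o => p (widen_ord mn o.1, widen_ord mn o.2)].
apply: leq_trans (leq_imset_card r _); apply/subset_leq_card/fintype.subsetP => p.
move=> /langP[x Xx <-]; apply/imsetP; exists (read n x 0); first exact: read_lang.
by apply/ffunP => o; rewrite !ffunE.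
Qed.

Lemma cell_index_subproof k n (c : 'I_k) (i : 'I_n) : (c * n + i < k * n)%N.
Proof. by case: c i => [c hc] [i hi] /=; nia. Qed.

Definition cell_index k n (c : 'I_k) (i : 'I_n) : 'I_(k * n) :=
  Ordinal (cell_index_subproof c i).

Lemma cell_indexP k n (j : 'I_(k * n)) : exists c i, j = cell_index c i :> 'I_(k * n).
Proof.
case: j => j hj; have n0 : (0 < n)%N by case: n hj => //; rewrite muln0.
have hc : (j %/ n < k)%N by rewrite ltn_divLR.
have hi : (j %% n < n)%N by rewrite ltn_mod.
by exists (Ordinal hc), (Ordinal hi); apply: val_inj => /=; rewrite -divn_eq.
Qed.

Definition cells k n (p : {ffun 'I_(k * n) * 'I_(k * n) -> A}) :
    {ffun 'I_k * 'I_k -> {ffun 'I_n * 'I_n -> A}} :=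
  [ffun c => [ffun o => p (cell_index c.1 o.1, cell_index c.2 o.2)]].

Lemma cells_inj k n : injective (@cells k n).
Proof.
move=> p q e; apply/ffunP => -[j1 j2].
have [c1 [i1 ->]] := cell_indexP j1; have [c2 [i2 ->]] := cell_indexP j2.
by have /ffunP/(_ (c1, c2))/[!ffunE]/ffunP/(_ (i1, i2))/[!ffunE] := e.
Qed.

Lemma cells_read k n (x : config A) t (c : 'I_k * 'I_k) :
  cells (read (k * n) x t) c = read n x (t + (c.1%:Z * n%:Z, c.2%:Z * n%:Z)).
Proof.
apply/ffunP => o; rewrite !ffunE /offset /= -addrA; congr (x (_ + _)).
Qed.

(** A pattern is determined by its restrictions to the [k * k] squares of side
    [n] that tile it. *)
Lemma lang_submult k n : (#|lang X (k * n)| <= #|lang X n| ^ (k * k))%N.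
Proof.
have <- : #|@cells k n @: lang X (k * n)| = #|lang X (k * n)|.
  by apply: card_imset; exact: cells_inj.
have -> : (k * k = #|{: 'I_k * 'I_k}|)%N by rewrite card_prod card_ord.
rewrite -card_ffun_on; apply/subset_leq_card/fintype.subsetP => f /imsetP[p /langP[x Xx <-] ->].
by apply/ffun_onP => c; rewrite cells_read; exact: read_lang.
Qed.

End Language.

(** * Entropy as a limit, and the gap it provides *)

Section Fekete.
Variables (R : realType) (a : nat -> nat).
Hypothesis a_gt0 : forall n, (0 < a n)%N.
Hypothesis a_mono : forall m n, (m <= n)%N -> (a m <= a n)%N.
Hypothesis a_submult : forall k n, (a (k * n) <= a n ^ (k * k))%N.

Definition growth (n : nat) : R := ((n ^ 2)%N%:R)^-1 * ln (a n)%:R.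

Lemma ln_count_ge0 n : 0 <= ln (a n)%:R :> R.
Proof. by apply: ln_ge0; rewrite ler1n. Qed.

Lemma growth_ge0 n : 0 <= growth n.
Proof. by rewrite mulr_ge0 ?invr_ge0 ?ler0n ?ln_count_ge0. Qed.

(** A square of side [m] is contained in one of side [k * n <= m + n]. *)
Lemma ln_count_le n m : (0 < n)%N ->
  ln (a m)%:R <= ((m + n)%N%:R) ^+ 2 * growth n :> R.
Proof.
move=> n0; set k := (m %/ n).+1.
have mkn : (m <= k * n)%N by rewrite ltnW // ltn_ceil.
have knm : (k * n <= m + n)%N by rewrite mulSn addnC leq_add2r leq_trunc_div.
have h : (a m <= a n ^ (k * k))%N := leq_trans (a_mono mkn) (a_submult k n).
have h2 : ln (a m)%:R <= (k * k)%N%:R * ln (a n)%:R :> R.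
  rewrite mulr_natl -lnXn ?ltr0n // -natrX ler_ln ?ler_nat // posrE ltr0n ?expn_gt0 ?a_gt0 //.
apply: (le_trans h2); rewrite /growth mulrA ler_wpM2r ?ln_count_ge0 //.
rewrite ler_pdivlMr ?ltr0n ?expn_gt0 ?n0 // -natrX -natrM ler_nat.
by rewrite -!mulnn mulnACA leq_mul.
Qed.

(** Fekete's argument in two dimensions: by [ln_count_le] each [growth n] bounds the
    upper limit, so the sequence tends to its infimum over [n > 0]. *)
Lemma growth_cvg : cvgn growth.
Proof.
pose E : set R := [set growth n | n in [set n | (0 < n)%N]].
have Einf : has_inf E.
  split; first by exists (growth 1); exists 1%N.
  by exists 0 => _ [n _ <-]; exact: growth_ge0.
apply/cvg_ex; exists (inf E); apply/cvgrPdist_lt => e e0.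
have e20 : 0 < e / 2 by rewrite divr_gt0.
have [_ [n /= n0 <-] cl] := inf_adherent e20 Einf.
set c := growth n in cl.
have c0 : 0 <= c := growth_ge0 n.
(* [K] makes [6 c n / m < e], and [(1 + t)^2 <= 1 + 3 t] when [t <= 1]. *)
pose K := 6 * c * n%:R / e.
have K0 : 0 <= K by apply: divr_ge0; [apply: mulr_ge0 => //; exact: mulr_ge0|exact: ltW].
apply: filterS (nbhs_infty_ge (maxn n (Num.bound K))) => m /= hm.
have nm : (n <= m)%N by apply: leq_trans hm; exact: leq_maxl.
have m0 : (0 < m)%N := leq_trans n0 nm.
have lm : inf E <= growth m by apply: ge_inf; [exact: Einf.2|exists m].
have Km : K < m%:R.
  apply: (lt_le_trans (archi_boundP K0)); rewrite ler_nat.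
  by apply: leq_trans hm; exact: leq_maxr.
have mR0 : 0 < m%:R :> R by rewrite ltr0n.
have nmR : n%:R <= m%:R :> R by rewrite ler_nat.
have nR0 : 0 < n%:R :> R by rewrite ltr0n.
have um : growth m <= (1 + n%:R / m%:R) ^+ 2 * c.
  rewrite {1}/growth ler_pdivrMl ?ltr0n ?expn_gt0 ?m0 //.
  suff -> : (m ^ 2)%N%:R * ((1 + n%:R / m%:R) ^+ 2 * c) = (m + n)%N%:R ^+ 2 * c.
    exact: ln_count_le.
  by rewrite natrX natrD; field; rewrite gt_eqF.
have t1 : n%:R / m%:R <= 1 :> R by rewrite ler_pdivrMr // mul1r.
have t0 : 0 <= n%:R / m%:R :> R by apply: divr_ge0; exact: ltW.
have ct : 6 * (c * (n%:R / m%:R)) < e.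
  have -> : 6 * (c * (n%:R / m%:R)) = 6 * c * n%:R / m%:R by rewrite !mulrA.
  by move: Km; rewrite /K !ltr_pdivrMr // [e * _]mulrC.
set t := n%:R / m%:R in um t1 t0 ct.
have ct0 : 0 <= c * t by rewrite mulr_ge0.
have : (1 + t) ^+ 2 * c <= c + 3 * (c * t) by nra.
rewrite ler0_norm ?subr_le0 // opprB => h.
lra.
Qed.

End Fekete.

Lemma entropyE (R : realType) (A : finType) (X : set (config A)) x :
  (forall t x, X x -> X (sigma t x)) -> X x ->
  entropy R X = (limn (growth R (fun n => #|lang X n|)))%:E.
Proof.
move=> XS Xx.
have a0 n : (0 < #|lang X n|)%N := lang_gt0 XS n Xx.
rewrite /entropy.
have -> : (fun n : nat => (((n ^ 2)%N%:R : R)^-1%:E *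
     lne ((#|` fset_set (language_on (csquare n) X)|%fset)%:R : R)%:E)%E) =
   (fun n => (growth R (fun n => #|lang X n|) n)%:E).
  apply/funext => n; rewrite card_language_on // lne_EFin ?ltr0n //.
apply/cvg_lim => //; apply: cvg_EFin; first exact: nearW.
apply: growth_cvg => //; [exact: lang_mono|exact: lang_submult].
Qed.

Lemma cvg_shift_eq (R : realType) (u : nat -> R) (l : R) (k : nat) (h : nat -> nat) :
  (forall n, h n = (n + k)%N) -> u @ \oo --> l -> (fun n => u (h n)) @ \oo --> l.
Proof. by move=> /funext -> ul; rewrite cvg_shiftn. Qed.

(** Were the inequality to fail for all [n], then dividing logarithms by [n ^ 2]
    would give [la <= lb] in the limit: neither the shift by [g] nor the
    polynomial term changes the growth rate. *)
Lemma count_gap (R : realType) (a b : nat -> nat) (g : nat) (la lb : R) :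
  (forall n, (0 < a n)%N) -> (forall n, (0 < b n)%N) ->
  growth R a @ \oo --> la -> growth R b @ \oo --> lb -> lb < la ->
  exists2 n, (0 < n)%N & (b (n + g) + (7 * (n + g) ^ 2) ^ 2 < a n)%N.
Proof.
move=> a0 b0 al bl ll; apply: contrapT => none; move: ll; apply/negP; rewrite -leNgt.
have h n : (a n.+1 <= b (n.+1 + g) + (7 * (n.+1 + g) ^ 2) ^ 2)%N.
  by rewrite leqNgt; apply/negP => lt; apply: none; exists n.+1.
have al' : (fun n => growth R a n.+1) @ \oo --> la.
  by apply: (cvg_shift_eq (k := 1)) al => n; rewrite addn1.
have bl' : (fun n => growth R b (n.+1 + g)) @ \oo --> lb.
  by apply: (cvg_shift_eq (k := g.+1)) bl => n; rewrite addnS.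
pose f n : R := (1 + g%:R * harmonic n) ^+ 2 *
  (growth R b (n.+1 + g) + 28 * harmonic n).
have hh := @cvg_harmonic R.
have c0 (c : R) : (fun n => c * harmonic n) @ \oo --> (0 : R).
  by rewrite -[X in _ --> X](mulr0 c); apply: cvgMr.
have fl : f @ \oo --> lb.
  rewrite (_ : lb = (1 + 0) ^+ 2 * (lb + 0)); last by rewrite !addr0 expr1n mul1r.
  apply: cvgM; last exact: cvgD.
  rewrite expr2; under eq_cvg do rewrite expr2.
  by apply: cvgM; apply: cvgD => //; exact: cvg_cst.
apply: (ler_cvg_to al' fl); apply: nearW => n.
rewrite /f /growth /harmonic; set N := (n.+1 + g)%N.
have n0 : 0 < n.+1%:R :> R by rewrite ltr0n.
have N0 : 0 < N%:R :> R by rewrite ltr0n.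
have nN : n.+1%:R <= N%:R :> R by rewrite ler_nat leq_addr.
have lnab : ln (a n.+1)%:R <= ln (b N)%:R + 28 * N%:R :> R.
  have h1 : (a n.+1)%:R <= (b N)%:R * (1 + (7 * N%:R)) ^+ 4 :> R.
    have : (a n.+1)%:R <= (b N)%:R + (7 * N%:R ^+ 2) ^+ 2 :> R.
      by rewrite -!natrX -natrM -natrX -natrD ler_nat; exact: h.
    move=> /le_trans; apply.
    have b1 : 1 <= (b N)%:R :> R by rewrite ler1n.
    have c1 : (7 * N%:R ^+ 2) ^+ 2 + 1 <= (1 + 7 * N%:R) ^+ 4 :> R.
      by move: (N%:R) N0 => q q0; nra.
    have c2 : 0 <= (7 * N%:R ^+ 2) ^+ 2 :> R by apply: sqr_ge0.
    move: (_ ^+ 4) c1 => r; move: ((7 * _) ^+ 2) c2 => q q0 hr.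
    nra.
  have p0 : 0 < 1 + 7 * N%:R :> R by lra.
  have e0 : 0 < (b N)%:R :> R by rewrite ltr0n.
  have h2 : ln (a n.+1)%:R <= ln ((b N)%:R * (1 + 7 * N%:R) ^+ 4) :> R.
    by rewrite ler_ln // posrE ?ltr0n // mulr_gt0 // exprn_gt0.
  apply: (le_trans h2); rewrite lnM ?posrE ?exprn_gt0 // lnXn //.
  rewrite lerD2l -[ln _ *+ 4]mulr_natl.
  have : ln (1 + 7 * N%:R) <= 7 * N%:R :> R by apply: le_ln1Dx; lra.
  lra.
rewrite ler_pdivrMl ?ltr0n ?expn_gt0 //.
apply: (le_trans lnab).
have -> : 1 + g%:R / n.+1%:R = N%:R / n.+1%:R :> R.
  by rewrite natrD mulrDl divff // gt_eqF.
rewrite !natrX.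
have -> : n.+1%:R ^+ 2 * ((N%:R / n.+1%:R) ^+ 2 *
    ((N%:R ^+ 2)^-1 * ln (b N)%:R + 28 / n.+1%:R)) =
  ln (b N)%:R + 28 * N%:R * (N%:R / n.+1%:R) :> R.
  by field; rewrite !gt_eqF.
rewrite lerD2l ler_peMr //.
by rewrite ler_pdivlMr // mul1r.
Qed.

(** The term [(7 * N0 ^ 2) ^ 2], with [N0 = n + g], is room for the subpatterns of
    the marker. *)
Lemma entropy_gap (R : realType) (A B : finType) (X : set (config A))
    (Y : set (config B)) y (g : nat) :
  (forall t x, X x -> X (sigma t x)) -> (forall t y, Y y -> Y (sigma t y)) ->
  Y y -> (entropy R Y < entropy R X)%E ->
  exists2 n, (0 < n)%N &
    (#|lang Y (n + g)| + (7 * (n + g) ^ 2) ^ 2 < #|lang X n|)%N.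
Proof.
move=> XS YS Yy.
have [X0|/set0P[x Xx]] := eqVneq X set0.
  rewrite [X in (_ < X)%E](_ : _ = -oo%E) ?ltNge ?leNye //.
  apply/cvg_lim => //.
  apply: cvg_near_cst; apply: filterS (nbhs_infty_gt 0) => n /= n0.
  rewrite card_language_on // (_ : #|_| = 0%N); last first.
    by apply: eq_card0 => p; apply/negP => /langP[x]; rewrite X0.
  by rewrite lexx gt0_muleNy // lte_fin invr_gt0 ltr0n expn_gt0 n0.
rewrite (entropyE R XS Xx) (entropyE R YS Yy) lte_fin.
have aX n : (0 < #|lang X n|)%N := lang_gt0 XS n Xx.
have aY n : (0 < #|lang Y n|)%N := lang_gt0 YS n Yy.
have cX := growth_cvg (R := R) aX (lang_mono XS) (lang_submult XS).
have cY := growth_cvg (R := R) aY (lang_mono YS) (lang_submult YS).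
exact: (count_gap g aX aY cX cY).
Qed.

(** * The marker *)

Definition scale (k : int) (c : Z2) : Z2 := (c.1 * k, c.2 * k).

Section Marker.
Variables (A : finType) (X : set (config A)) (g : nat).
Hypothesis Xsub : is_subshift X.
Hypothesis Xgl : gluing_gap X g.

(** If [t] were a period of every point of [X], two points that differ at [u]
    could not be glued with their [u]-letters placed at [0] and at
    [(1 + g) t]. *)
Lemma no_common_period (n : nat) : (1 < #|lang X n|)%N ->
  forall t : Z2, t != 0 -> exists x, X x /\ x 0 <> x t.
Proof.
move=> /card_gt1P[p [q [/langP[x Xx <-] /langP[x' Xx' <-] pq]]] t t0.
apply: contrapT => per.
have [u xu] : exists u, x u <> x' u.
  apply: contrapT => nu; case/eqP: pq; apply/ffunP => o; rewrite !ffunE.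
  by apply: contrapT => xo; apply: nu; exists (0 + offset o).
have per1 z s : X z -> z s = z (s + t).
  move=> Xz; apply: contrapT => zs; apply: per; exists (sigma s z).
  by split; [exact: Xsub.2|rewrite /sigma add0r addrC].
have perk z s (k : nat) : X z -> z s = z (s + scale k%:Z t).
  move=> Xz; elim: k => [|k IH]; first by rewrite /scale !mulr0 addr0.
  rewrite IH per1 // -addrA; congr (z (_ + _)).
  by case: (t) => t1 t2; congr pair => /=; lia.
pose xi c := sigma (u - scale (1 + g)%N%:Z c) (if c == 0 then x else x').
have Xxi c : X (xi c) by apply: Xsub.2; case: ifP.
have [z Xz zP] := glue_grid Xsub Xgl (isT : (0 < 1)%N) Xxi.
(* The cells [0] and [t] of the grid of single sites start at [0] and [(1 + g) t]. *)
have z0 : z 0 = x u.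
  rewrite (zP 0 0); first by rewrite /xi eqxx /sigma /scale !mul0r subr0 add0r.
  by rewrite /in_cell /=; lia.
have zt : z (scale (1 + g)%N%:Z t) = x' u.
  rewrite (zP t); first by rewrite /xi (negbTE t0) /sigma addrC subrK.
  by rewrite /in_cell /scale /=; lia.
by apply: xu; rewrite -z0 -zt (perk z 0 (1 + g)%N) // add0r.
Qed.

(** Cells of side [2 r] are indexed by the displacements [t] with [|t| < r], shifted
    by [mid] to become nonnegative; the cell of [t] holds a point that
    distinguishes its centre from the site displaced by [t]. *)
Lemma self_conflicting_point (r : nat) : (0 < r)%N ->
  (forall t : Z2, t != 0 -> exists x, X x /\ x 0 <> x t) ->
  exists2 m, X m & forall t : Z2, t != 0 -> `|t.1| < r%:Z -> `|t.2| < r%:Z ->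
    exists v : Z2, [/\ m v <> m (v + t),
      csquare (2 * r * (2 * r + g)) v & csquare (2 * r * (2 * r + g)) (v + t)].
Proof.
move=> r0 ap.
pose mid : Z2 := (r%:Z, r%:Z).
have ap' (t : Z2) : exists x, X x /\ (t != 0 -> x 0 <> x t).
  have [t0|t0] := eqVneq t 0; last by have [x [Xx xt]] := ap t t0; exists x.
  by have [x [Xx _]] := ap (1, 0) isT; exists x.
have [y yP] := choice ap'.
set K := (2 * r + g)%N.
pose v c : Z2 := scale K%:Z c + mid.
pose xi c := sigma (- v c) (y (c - mid)).
have Xxi c : X (xi c) by apply: Xsub.2; exact: (yP _).1.
have r2 : (0 < 2 * r)%N by lia.
have [m Xm mP] := glue_grid Xsub Xgl r2 Xxi.
exists m => // t t0 t1r t2r.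
exists (v (t + mid)); split.
- rewrite !(mP (t + mid)); first last.
  + rewrite /in_cell /v /scale -/K /=; lia.
  + rewrite /in_cell /v /scale -/K /=; lia.
  by rewrite /xi /sigma subrr addrK addrAC subrr add0r; exact: (yP t).2.
- have : (t.1 + r%:Z) * K%:Z <= (2 * r%:Z - 1) * K%:Z by apply: ler_wpM2r; lia.
  have : (t.2 + r%:Z) * K%:Z <= (2 * r%:Z - 1) * K%:Z by apply: ler_wpM2r; lia.
  have : 0 <= (t.1 + r%:Z) * K%:Z by apply: mulr_ge0; lia.
  have : 0 <= (t.2 + r%:Z) * K%:Z by apply: mulr_ge0; lia.
  rewrite /csquare /box /v /scale /=; rewrite /K; lia.
- have : (t.1 + r%:Z) * K%:Z <= (2 * r%:Z - 1) * K%:Z by apply: ler_wpM2r; lia.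
  have : (t.2 + r%:Z) * K%:Z <= (2 * r%:Z - 1) * K%:Z by apply: ler_wpM2r; lia.
  have : 0 <= (t.1 + r%:Z) * K%:Z by apply: mulr_ge0; lia.
  have : 0 <= (t.2 + r%:Z) * K%:Z by apply: mulr_ge0; lia.
  rewrite /csquare /box /v /scale /=; rewrite /K; lia.
Qed.

End Marker.

(** * Encoding blocks *)

Lemma leq_exp_base (a b e : nat) : (a <= b)%N -> (a ^ e <= b ^ e)%N.
Proof. by case: e => [//|e] ab; rewrite leq_exp2r. Qed.

(** The first two terms of the binomial expansion of [(q + 1) ^ q]. *)
Lemma double_exp_succ (q : nat) : (0 < q)%N -> (2 * q ^ q <= q.+1 ^ q)%N.
Proof.
case: q => // p _.
rewrite -[p.+2]addn1 expnDn big_ord_recl big_ord_recl /= bin0 mul1n subn0 exp1n muln1.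
rewrite /bump /= bin1 exp1n muln1 subn1 /= -expnS addnA mul2n -addnn leq_addr //.
Qed.

(** One more letter in the alphabet makes up for [l] missing sites as soon as there
    are [q ^ 2 * l] sites: [double_exp_succ] gains [2 ^ (q * l)], hence
    [q ^ l]. *)
Lemma expn_gap (q l E : nat) : (q * (q * l) <= E)%N -> (q ^ (E + l) <= q.+1 ^ E)%N.
Proof.
have [->|q0] := posnP q.
  by rewrite exp1n; case: (E + l)%N => // e; rewrite exp0n.
move=> hE; rewrite -(subnKC hE); set r := (E - _)%N.
rewrite addnAC !expnD leq_mul //; last exact: leq_exp_base.
rewrite [(q.+1 ^ _)%N]expnM.
apply: leq_trans (leq_exp_base (q * l) (double_exp_succ q0)).
rewrite expnMn -!expnM mulnC leq_mul // expnM leq_exp_base //.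
by rewrite ltnW // ltn_expl.
Qed.

Lemma finset_embedding (T U : finType) (P : {pred T}) (Q : {pred U}) :
  (0 < #|P|)%N -> (#|P| <= #|Q|)%N ->
  exists (f : T -> U) (h : U -> T), forall u, u \in P -> f u \in Q /\ h (f u) = u.
Proof.
move=> /card_gt0P[t0 Pt0] PQ.
have /card_gt0P[u0 Qu0] : (0 < #|Q|)%N by apply: leq_trans PQ; apply/card_gt0P; exists t0.
exists (fun t => nth u0 (enum Q) (index t (enum P))).
exists (fun u => nth t0 (enum P) (index u (enum Q))) => t Pt.
have lt : (index t (enum P) < size (enum Q))%N.
  by rewrite -cardE; apply: leq_trans PQ; rewrite cardE index_mem mem_enum.
split; first by rewrite -mem_enum mem_nth.
by rewrite index_uniq ?enum_uniq // nth_index // mem_enum.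
Qed.

Lemma small_multiple (d M : int) : 0 < M -> `|d * M| < M -> d = 0.
Proof.
move=> M0; rewrite normrM (ger0_norm (ltW M0)) -[X in _ < X]mul1r ltr_pM2r //; lia.
Qed.

Lemma cell_in_window (N0 L : nat) (s : int) : (0 < N0)%N -> (1 < L)%N ->
  exists D : int, s <= D * N0%:Z <= s + (L%:Z - 1) * N0%:Z.
Proof.
move=> N00 L1; exists (divz s N0%:Z + 1).
have := divz_eq s N0%:Z; have := modz_ge0 s (d := N0%:Z); have := @ltz_pmod s N0%:Z.
set q := divz _ _; set o := modz _ _ => h1 h2 h3.
have : 1 * N0%:Z <= (L%:Z - 1) * N0%:Z by apply: ler_wpM2r; lia.
by rewrite mulrDl; lia.
Qed.

(** A window of [L] cells of the lattice [N0 Z] starting at [s], seen modulo a block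
    of [M] cells whose first [L] cells belong to the marker: [a] and [b] are the
    first and the last lattice index with a cell inside the window.  If both
    belong to markers, it is to the same one because [2 L <= M], and then the
    window is within [N0] of it. *)
Lemma window_near_block (N0 L M s a b k k' r r' p p' : int) :
  0 < N0 -> 2 * L <= M ->
  s = a * N0 - p -> s = (b - (L - 1)) * N0 + p' -> 0 <= p < N0 -> 0 <= p' < N0 ->
  a = k * M + r -> b = k' * M + r' -> 0 <= r < L -> 0 <= r' < L ->
  `|s - k * M * N0| < N0.
Proof.
move=> N00 LM sa sb hp hp' ak bk hr hr'.
pose e := b - a - (L - 1).
have eN : e * N0 = - (p + p').
  have -> : e * N0 = (b - (L - 1)) * N0 - a * N0 by rewrite /e; ring.
  by clear - sa sb; lia.
have e1 : e <= 0 by rewrite -(ler_pM2r N00) eN mul0r; clear - hp hp'; lia.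
have e2 : -2 < e by rewrite -(ltr_pM2r N00) eN mulNr; clear - hp hp'; lia.
have kk : k' - k = 0.
  apply: (@small_multiple _ M); first by clear - LM hr; lia.
  have -> : (k' - k) * M = e + (L - 1) + r - r' by rewrite /e ak bk; ring.
  by clear - e1 e2 hr hr' LM; lia.
have er : r + L - 1 + e = r'.
  have : b = k * M + r' by rewrite bk; congr (_ * _ + _); clear - kk; lia.
  by rewrite /e ak; clear; lia.
have -> : s - k * M * N0 = r * N0 - p by rewrite sa ak; ring.
have [->|[r1 em]] : r = 0 \/ r = 1 /\ e = -1 by clear - er hr hr' e1 e2; lia.
  by rewrite mul0r; clear - hp; lia.
by rewrite em in eN; rewrite r1 mul1r; clear - eN hp hp'; lia.
Qed.

Lemma locate_window (N0 L J : nat) (s : int) :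
  (0 < N0)%N -> (1 < L)%N -> (1 < J)%N ->
  (exists k : int, `|s - k * (J * L * N0)%N%:Z| < N0%:Z) \/
  (exists D : int, s <= D * N0%:Z <= s + (L%:Z - 1) * N0%:Z /\
     L%:Z <= modz D (J * L)%N%:Z).
Proof.
move=> N00 L1 J1.
have JL : (2 * L <= J * L)%N by rewrite leq_mul2r J1 orbT.
have nz : N0%:Z != 0 by rewrite eqz_nat -lt0n.
have pz : 0 < N0%:Z by rewrite ltz_nat.
have Mz : (J * L)%N%:Z != 0 by clear - JL L1; lia.
pose a := - divz (- s) N0%:Z; pose p := modz (- s) N0%:Z.
pose b := divz s N0%:Z + (L%:Z - 1); pose p' := modz s N0%:Z.
have hp : 0 <= p < N0%:Z by rewrite modz_ge0 // ltz_pmod.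
have hp' : 0 <= p' < N0%:Z by rewrite modz_ge0 // ltz_pmod.
have sa : s = a * N0%:Z - p by rewrite /a /p mulNr -opprD -divz_eq opprK.
have sb : s = (b - (L%:Z - 1)) * N0%:Z + p' by rewrite /b /p' addrK -divz_eq.
have oq : 0 <= (L%:Z - 2) * N0%:Z by apply: mulr_ge0; clear - L1; lia.
have [ha|ha] := lerP L%:Z (modz a (J * L)%N%:Z).
  by right; exists a; split => //; clear - sa hp oq; lia.
have [hb|hb] := lerP L%:Z (modz b (J * L)%N%:Z).
  right; exists b; split => //.
  have -> : b * N0%:Z = (b - (L%:Z - 1)) * N0%:Z + (L%:Z - 1) * N0%:Z by ring.
  by clear - sb hp' oq; lia.
left; exists (divz a (J * L)%N%:Z); rewrite [(J * L * N0)%N%:Z]PoszM mulrA.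
apply: (window_near_block pz _ sa sb hp hp' (divz_eq a _) (divz_eq b _)).
- by rewrite -[2]/(2%:Z) -PoszM lez_nat.
- by rewrite modz_ge0 // ha.
- by rewrite modz_ge0 // hb.
Qed.

(** * Parsing a configuration into blocks *)

Section Markers.
Variables (A : finType) (F r : nat) (m : config A).

Definition premarker (x : config A) (s : Z2) : bool := read F x s == read F m 0.

(** Only isolated occurrences count, which separates the markers of an arbitrary
    point; the displacements up to [r] are enumerated by [offset w - (r, r)]. *)
Definition marker (x : config A) (s : Z2) : bool :=
  premarker x s && [forall w : 'I_(2 * r).+1 * 'I_(2 * r).+1,
    premarker x (s + offset w - (r%:Z, r%:Z)) ==> (offset w == (r%:Z, r%:Z))].

Lemma premarker_sigma x t s : premarker (sigma t x) s = premarker x (s + t).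
Proof. by rewrite /premarker read_sigma. Qed.

Lemma marker_sigma x t s : marker (sigma t x) s = marker x (s + t).
Proof.
rewrite /marker premarker_sigma; congr andb; apply: eq_forallb => w.
by rewrite premarker_sigma -!addrA [t + _]addrC -!addrA.
Qed.

Lemma read_fd n s : finitely_determined (fun x : config A => read n x s).
Proof.
have f := @fd_family A _ _ (fun (o : 'I_n * 'I_n) x => x (s + offset o)) (fun o => @fd_site A _).
exact: (fd_comp (fun p : _ -> A => [ffun o : 'I_n * 'I_n => p o]) f).
Qed.

Lemma marker_fd s : finitely_determined (marker^~ s).
Proof.
have f0 := read_fd F s.
have f := @fd_family A _ _ (fun (w : 'I_(2 * r).+1 * 'I_(2 * r).+1) x =>
  read F x (s + offset w - (r%:Z, r%:Z))) (fun w => read_fd F _).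
exact: (fd_comp (fun p => (p.1 == read F m 0) && [forall w : 'I_(2 * r).+1 * 'I_(2 * r).+1,
  (p.2 w == read F m 0) ==> (offset w == (r%:Z, r%:Z))]) (fd_pair f0 f)).
Qed.

Lemma premarker_marker x s : premarker x s ->
  (forall t, premarker x t -> `|s.1 - t.1| <= r%:Z -> `|s.2 - t.2| <= r%:Z -> t = s) ->
  marker x s.
Proof.
move=> Ps sep; rewrite /marker Ps /=; apply/forallP => w; apply/implyP => Pw.
have := sep _ Pw; case: w {Pw} => [ [i1 h1] [i2 h2] ] /= e.
have {}e : s + (i1%:Z, i2%:Z) - (r%:Z, r%:Z) = s by apply: e; lia.
apply/eqP; rewrite /offset /=; move: e; rewrite -addrA => /(congr1 (fun v : Z2 => - s + v)).
by rewrite addKr addNr => /eqP; rewrite subr_eq0 => /eqP.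
Qed.

Lemma marker_sep x s t : marker x s -> marker x t ->
  `|s.1 - t.1| <= r%:Z -> `|s.2 - t.2| <= r%:Z -> s = t.
Proof.
move=> /andP[_ /forallP iso] /andP[Pt _] h1 h2.
have : csquare (2 * r).+1 (t - s + (r%:Z, r%:Z)) by rewrite /csquare /box /=; lia.
move=> /csquare_offset[w ew]; have := iso w.
rewrite -ew addrA addrK addrC subrK Pt /= => /eqP e.
apply/esym/eqP; rewrite -subr_eq0; apply/eqP.
by apply: (addIr (r%:Z, r%:Z)); rewrite add0r.
Qed.

End Markers.

Lemma Z2_divmod (k : nat) (s : Z2) : (0 < k)%N ->
  exists (c : Z2) (o : 'I_k * 'I_k), s = scale k%:Z c + offset o.
Proof.
move=> k0.
have [r eo] : exists o : 'I_k * 'I_k, (modz s.1 k%:Z, modz s.2 k%:Z) = offset o.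
  apply/csquare_offset; rewrite /csquare /box /=.
  have kz : k%:Z != 0 by lia.
  have kp : 0 < k%:Z by lia.
  have := modz_ge0 s.1 kz; have := modz_ge0 s.2 kz.
  have := ltz_pmod s.1 kp; have := ltz_pmod s.2 kp; lia.
exists (divz s.1 k%:Z, divz s.2 k%:Z), r; rewrite -eo.
by case: s {eo} => s1 s2; congr pair; exact: divz_eq.
Qed.

Lemma offset_mod (k : nat) (c : Z2) (o : 'I_k * 'I_k) :
  (modz (scale k%:Z c + offset o).1 k%:Z = o.1%:Z) *
  (modz (scale k%:Z c + offset o).2 k%:Z = o.2%:Z).
Proof.
by split; rewrite /scale /offset /= modzMDl modz_small //=; case: o => [ [i1 h1] [i2 h2] ] /=; lia.
Qed.

Lemma Z2_divmod_inj (k : nat) (c c' : Z2) (o q : 'I_k * 'I_k) :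
  scale k%:Z c + offset o = scale k%:Z c' + offset q -> c = c' /\ o = q.
Proof.
move=> e; have eo : o = q.
  have h1 := offset_mod c o; have h2 := offset_mod c' q; rewrite e in h1.
  by apply: offset_inj; rewrite /offset -h1.1 -h1.2 -h2.1 -h2.2.
split => //; move: e; rewrite eo => /addIr; case: c c' => [c1 c2] [d1 d2] [].
have k0 : k%:Z != 0 by case: o {eo} => [ [i1 h1] _ ]; lia.
by move=> /(mulIf k0) -> /(mulIf k0) ->.
Qed.

(** The square needed by [self_conflicting_point] fits in a marker of [L] cells with
    [L = 4 N0 + 3 g]. *)
Lemma marker_size_large (n g : nat) : (0 < n)%N ->
  (2 * (n + g) * (2 * (n + g) + g) <= (4 * (n + g) + 3 * g) * (n + g) - g)%N.
Proof. by move=> n0; rewrite leq_subRL; nia. Qed.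

Section Construction.
Variables (A B : finType) (X : set (config A)) (Y : set (config B)).
Variables (g n L J F : nat) (m : config A).
Hypothesis YS : forall t y, Y y -> Y (sigma t y).
Local Notation N0 := (n + g)%N.
Local Notation JL := (J * L)%N.
Local Notation N := (J * L * N0)%N.

(** Removing the subpatterns of [m] at all positions below [L * N0], more than
    fit in the marker, keeps the index type simple. *)
Definition data_letters : {set {ffun 'I_n * 'I_n -> A}} :=
  lang X n :\: [set read n m (offset v) | v : 'I_(L * N0) * 'I_(L * N0)].

Lemma card_data_letters q : (q + (L * N0) ^ 2 < #|lang X n|)%N ->
  (q < #|data_letters|)%N.
Proof.
move=> gap; rewrite cardsD ltn_subRL addnC; apply: leq_ltn_trans gap.
rewrite leq_add2l; apply: leq_trans (subset_leq_card (subsetIr _ _)) _.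
by apply: leq_trans (leq_imset_card _ _) _; rewrite card_prod !card_ord.
Qed.

(** The marker occupies the lower left [L * L] cells of a block. *)
Definition is_data (d : 'I_JL * 'I_JL) : bool := ~~ ((d.1 < L) && (d.2 < L))%N.

Lemma card_is_data : (0 < J)%N -> (JL * JL <= #|is_data| + L * L)%N.
Proof.
move=> J0.
have -> : (JL * JL = #|{: 'I_JL * 'I_JL}|)%N by rewrite card_prod !card_ord.
rewrite -(cardC is_data) leq_add2l.
have LJL : (L <= JL)%N by rewrite leq_pmull.
pose w (d : 'I_L * 'I_L) : 'I_JL * 'I_JL := (widen_ord LJL d.1, widen_ord LJL d.2).
have -> : (L * L = #|{: 'I_L * 'I_L}|)%N by rewrite card_prod !card_ord.
apply: leq_trans (leq_image_card w _); apply/subset_leq_card/fintype.subsetP => d.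
move=> hd; have /andP[h1 h2] : (d.1 < L)%N && (d.2 < L)%N.
  by apply: contraLR hd; rewrite !inE negbK.
by apply/fintype.imageP; exists (Ordinal h1, Ordinal h2) => //; case: d {hd} h1 h2 => d1 d2 h1 h2;
  congr pair; apply: val_inj.
Qed.

(** Cells under the marker carry a dummy value, so that a filling of the data cells
    is a function on the whole block. *)
Definition block_coding (enc : {ffun 'I_N * 'I_N -> B} ->
      {ffun 'I_JL * 'I_JL -> {ffun 'I_n * 'I_n -> A}})
    (dec : {ffun 'I_JL * 'I_JL -> {ffun 'I_n * 'I_n -> A}} ->
      {ffun 'I_N * 'I_N -> B}) : Prop :=
  forall u, u \in lang Y N ->
    [/\ dec (enc u) = u, forall d, is_data d -> enc u d \in data_letters
      & forall d, ~~ is_data d -> enc u d = read n m 0].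

Lemma block_coding_exists y : Y y ->
  (#|lang Y N0| < J)%N -> (#|lang Y N0| < #|data_letters|)%N ->
  exists enc dec, block_coding enc dec.
Proof.
set q := #|lang Y N0| => Yy qJ qS.
have [||enc [dec ed]] := @finset_embedding _ _ (mem (lang Y N))
   (pffun_on (read n m 0) is_data (mem data_letters)).
- exact: lang_gt0 Yy.
- rewrite card_pffun_on; apply: leq_trans (lang_submult YS JL N0) _.
  have q0 : (0 < q)%N by exact: lang_gt0 Yy.
  apply: leq_trans (leq_exp_base _ qS).
  have E := card_is_data (ltn_trans q0 qJ).
  apply: leq_trans (@expn_gap q (L * L) _ _); first by rewrite leq_pexp2l.
  rewrite -(leq_add2r (L * L)); apply: leq_trans E.
  by rewrite mulnA -mulSnr mulnACA leq_mul2r; apply/orP; right; nia.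
exists enc, dec => u /ed[/pffun_onP[/fintype.subsetP sup im] dk]; split => // d dd.
  by apply: im; apply/fintype.imageP; exists d.
by apply/eqP; apply: contraNT dd => nd; apply: sup.
Qed.

Variables (enc : {ffun 'I_N * 'I_N -> B} -> {ffun 'I_JL * 'I_JL -> {ffun 'I_n * 'I_n -> A}})
    (dec : {ffun 'I_JL * 'I_JL -> {ffun 'I_n * 'I_n -> A}} -> {ffun 'I_N * 'I_N -> B}).

Definition scan (x : config A) (s : Z2) : {ffun 'I_JL * 'I_JL -> {ffun 'I_n * 'I_n -> A}} :=
  [ffun d => if is_data d then read n x (s + scale N0%:Z (offset d)) else read n m 0].

Definition block_letter (x : config A) (s : Z2) (o : 'I_N * 'I_N) : B := dec (scan x s) o.

Lemma block_letter_sigma x t s o : block_letter (sigma t x) s o = block_letter x (s + t) o.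
Proof.
rewrite /block_letter; congr (dec _ _); apply/ffunP => d; rewrite !ffunE read_sigma.
by rewrite addrAC.
Qed.

Lemma block_letter_fd s o : finitely_determined (fun x => block_letter x s o).
Proof.
have f := @fd_family A _ _ (fun (d : 'I_JL * 'I_JL) x =>
  read n x (s + scale N0%:Z (offset d))) (fun d => @read_fd A n _).
exact: (fd_comp (fun p => dec [ffun d => if is_data d then p d else read n m 0] o) f).
Qed.

Hypothesis Xsub : is_subshift X.
Hypothesis Xgl : gluing_gap X g.
Hypothesis n0 : (0 < n)%N.
Hypothesis FE : (F + g = L * N0)%N.
Hypothesis F0 : (0 < F)%N.
Hypothesis L2 : (1 < L)%N.
Hypothesis J2 : (1 < J)%N.
Hypothesis Xm : X m.
Hypothesis m_conflict : forall t : Z2, t != 0 -> `|t.1| < N0%:Z -> `|t.2| < N0%:Z ->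
    exists v : Z2, [/\ m v <> m (v + t), csquare F v & csquare F (v + t)].
Hypothesis encP : block_coding enc dec.

(** Two gluings: [z1] carries the data on the small cells of spacing [N0]; then
    [z] has the marker on the big cells, of spacing [L * N0], whose index is
    divisible by [J], and copies [z1] on the others.  On these the second gluing
    loses no data, as the gaps between big cells lie in gaps between small
    ones. *)
Lemma encoded_point y : Y y -> exists x, [/\ X x,
  forall s, premarker F m x s <-> exists c, s = scale N%:Z c
  & forall c, scan x (scale N%:Z c) = enc (read N y (scale N%:Z c))].
Proof.
move=> Yy.
pose e c := enc (read N y (scale N%:Z c)).
have eP c := encP (read_lang YS N (scale N%:Z c) Yy).
have JL0 : (0 < JL)%N by nia.
have cellP (D : Z2) : exists x, X x /\ forall c d, D = scale JL%:Z c + offset d ->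
    is_data d -> read n x 0 = e c d.
  have [c [d De]] := Z2_divmod D JL0.
  have [dd|nd] := boolP (is_data d).
    have [_ h _] := eP c; have := h d dd; rewrite inE => /andP[_ /langP[x Xx xr]].
    exists x; split => // c' d'; rewrite De => /Z2_divmod_inj[<- <-] _; exact: xr.
  by exists m; split => // c' d'; rewrite De => /Z2_divmod_inj[_ <-]; rewrite (negbTE nd).
have [xi xiP] := choice cellP.
have [z1 Xz1 z1P] := glue_grid Xsub Xgl n0
  (fun D => Xsub.2 (- scale N0%:Z D) _ (xiP D).1).
have z1data c d : is_data d ->
    read n z1 (scale N0%:Z (scale JL%:Z c + offset d)) = e c d.
  move=> dd; rewrite -((xiP _).2 c d erefl dd); apply/ffunP => o; rewrite !ffunE.
  rewrite (z1P (scale JL%:Z c + offset d)).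
    by rewrite /sigma addrAC subrr.
  by rewrite /in_cell /scale /offset /=; case: (o) => [ [i1 h1] [i2 h2] ] /=; lia.
pose markq (c : Z2) := (modz c.1 J%:Z == 0) && (modz c.2 J%:Z == 0).
pose xi2 c := if markq c then sigma (- scale (F + g)%N%:Z c) m else z1.
have Xxi2 c : X (xi2 c) by rewrite /xi2; case: ifP => // _; exact: Xsub.2.
have [z Xz zP] := glue_grid Xsub Xgl F0 Xxi2.
have N0_gt0 : (0 < N0)%N by nia.
have pre c : premarker F m z (scale N%:Z c).
  apply/eqP/ffunP => o; rewrite !ffunE.
  rewrite (zP (scale J%:Z c)).
    rewrite /xi2 /markq /scale /= !modzMl !eqxx /= /sigma FE; congr (m _).
    rewrite add0r addrC addrA; rewrite (_ : - _ + _ = 0) ?add0r //.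
    by congr pair; rewrite /= !PoszM; ring.
  rewrite /in_cell /scale /offset FE /= !PoszM !mulrA.
  case: (o) => [ [i1 h1] [i2 h2] ] /=; lia.
have zdata c d : is_data d ->
    read n z (scale N0%:Z (scale JL%:Z c + offset d)) = e c d.
  move=> dd; rewrite -z1data //; apply/ffunP => o; rewrite !ffunE.
  set D := scale JL%:Z c + offset d.
  have L0 : (0 < L)%N by lia.
  have [b [l Dl]] := Z2_divmod D L0.
  rewrite (zP b).
    rewrite /xi2 ifN //; apply: contraNN dd; move=> /andP[/eqP b1 /eqP b2].
    have [h1 h2] := offset_mod b l; have [h3 h4] := offset_mod c d.
    have f1 := divz_eq b.1 J%:Z; have f2 := divz_eq b.2 J%:Z.
    rewrite b1 addr0 in f1; rewrite b2 addr0 in f2.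
    have : d = (widen_ord (leq_pmull L (ltnW J2)) l.1, widen_ord (leq_pmull L (ltnW J2)) l.2).
      apply: (@Z2_divmod_inj _ c (divz b.1 J%:Z, divz b.2 J%:Z) _ _ _).2.
      rewrite -/D Dl; congr (_ + _); rewrite /scale /=.
      by rewrite {1}f1 {1}f2 PoszM !mulrA.
    by move=> ->; rewrite /= !ltn_ord.
  rewrite Dl /in_cell FE /scale /offset /=.
  case: (o) (l) => [ [i1 h1] [i2 h2] ] [ [l1 k1] [l2 k2] ] /=.
  have Fe := FE.
  have : (l1 * N0 + N0 <= L * N0)%N by rewrite -mulSnr leq_mul2r k1 orbT.
  have : (l2 * N0 + N0 <= L * N0)%N by rewrite -mulSnr leq_mul2r k2 orbT.
  have -> : (b.1 * L%:Z + l1%:Z) * N0%:Z = b.1 * (L * N0)%N%:Z + (l1 * N0)%N%:Z by rewrite !PoszM; ring.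
  have -> : (b.2 * L%:Z + l2%:Z) * N0%:Z = b.2 * (L * N0)%N%:Z + (l2 * N0)%N%:Z by rewrite !PoszM; ring.
  move: (b.1 * _) (b.2 * _) (l1 * _)%N (l2 * _)%N Fe => B1 B2 l1' l2'.
  move: (L * N0)%N F => LN FF; lia.
exists z; split => //; last first.
  move=> c; apply/ffunP => d; rewrite ffunE.
  have [dd|nd] := boolP (is_data d); last by have [_ _ ->] := eP c.
  rewrite -[RHS](zdata c d dd); congr read; rewrite /scale /=.
  by congr pair; rewrite /= !PoszM; ring.
move=> s; split; last by move=> [c ->].
move=> Ps.
(* An occurrence containing a whole data cell would make the contents of that
   cell a subpattern of [m], and those were excluded from [data_letters]. *)
have far (D1 D2 : int) : s.1 <= D1 * N0%:Z <= s.1 + (L%:Z - 1) * N0%:Z ->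
    s.2 <= D2 * N0%:Z <= s.2 + (L%:Z - 1) * N0%:Z ->
    (L%:Z <= modz D1 JL%:Z) || (L%:Z <= modz D2 JL%:Z) -> False.
  move=> s1 s2 hD.
  have [c [d De]] := Z2_divmod (D1, D2) JL0.
  have dd : is_data d.
    have [h1 h2] := offset_mod c d; rewrite -De /= in h1 h2.
    by move: hD; rewrite h1 h2 /is_data; rewrite !lez_nat negb_and -!leqNgt.
  have LN : (L%:Z - 1) * N0%:Z + N0%:Z = (L * N0)%N%:Z by rewrite PoszM; ring.
  have [v ve] : exists v : 'I_(L * N0) * 'I_(L * N0), scale N0%:Z (D1, D2) - s = offset v.
    by apply/csquare_offset; rewrite /csquare /box /scale /=; lia.
  have [_ h _] := eP c; have := h d dd; rewrite -/(e c) -zdata // -De inE => /andP[/negP nb _]; apply: nb.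
  apply/imsetP; exists v => //; rewrite -ve.
  apply/ffunP => o; rewrite !ffunE.
  have /csquare_offset[w we] : csquare F (scale N0%:Z (D1, D2) - s + offset o).
    rewrite /csquare /box /scale /offset /=; case: (o) => [ [i1 k1] [i2 k2] ] /=.
    have Fe := FE; lia.
  have /eqP/ffunP/(_ w) := Ps; rewrite !ffunE -we add0r => <-.
  by congr (z _); rewrite addrA [s + _]addrC subrK.
have [D1 hD1] := cell_in_window s.1 N0_gt0 L2.
have [D2 hD2] := cell_in_window s.2 N0_gt0 L2.
have [ [k1 hk1]|[E1 [hE1 hE1']] ] := locate_window s.1 N0_gt0 L2 J2; last first.
  by case: (far E1 D2) => //; rewrite hE1'.
have [ [k2 hk2]|[E2 [hE2 hE2']] ] := locate_window s.2 N0_gt0 L2 J2; last first.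
  by case: (far D1 E2) => //; rewrite hE2' orbT.
exists (k1, k2); apply/eqP; rewrite -subr_eq0; apply: contraT => t0.
have [v [mv /csquare_offset[v1 e1] /csquare_offset[v2 e2]]] := m_conflict t0 hk1 hk2.
case: mv; rewrite e2 e1.
have /eqP/ffunP/(_ v1) := Ps; rewrite !ffunE add0r => <-.
have /eqP/ffunP/(_ v2) := pre (k1, k2); rewrite !ffunE add0r => <-.
congr (z _); rewrite -e2 -e1.
by rewrite addrCA [scale _ _ + _]addrC subrK addrC.
Qed.

End Construction.

(** * The factor map *)

Theorem corollary1p7 (R : realType) (A B : finType)
    (X : set (config A)) (Y : set (config B))
    (hX : is_subshift X) (hXg : block_gluing X)
    (hY : is_sft Y) (hYf : single_site_fillable Y)
    (hYfix : exists y : config B, is_fixed_point Y y)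
    (hent : (entropy R Y < entropy R X)%E) :
  exists phi : config A -> config B, is_factor_map X Y phi.
Proof.
have [g Xgl] := hXg.
have [H [V [YE fillable]]] := hYf.
have [y0 [Yy0 y0fix]] := hYfix.
have YS := hY.1.2.
have adjY z : adjacency_shift H V z -> Y z by rewrite YE.
have Yadj z : Y z -> adjacency_shift H V z by rewrite YE.
have [n n0 gap] := entropy_gap g hX.2 YS Yy0 hent.
have y0E t : y0 t = y0 0 by rewrite -[in RHS](y0fix t) /sigma add0r.
have [b0H b0V] : ~~ H (y0 0) (y0 0) /\ ~~ V (y0 0) (y0 0).
  by have := Yadj _ Yy0 0; rewrite !(y0E (0 + _)).
have N0_gt0 : (0 < n + g)%N by rewrite addn_gt0 n0.
have lang2 : (1 < #|lang X n|)%N.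
  by apply: leq_ltn_trans gap; rewrite addn_gt0 (lang_gt0 YS _ Yy0).
have [m Xm mP] := self_conflicting_point hX Xgl N0_gt0 (no_common_period hX Xgl lang2).
set N0 := (n + g)%N in gap N0_gt0 mP.
(* [F] leaves room for the gap in [L] cells of spacing [N0]; [J] is chosen so that
   [J ^ 2] exceeds [q ^ 2], as [expn_gap] requires with [q = #|lang Y N0|]. *)
pose L := (4 * N0 + 3 * g)%N; pose F := (L * N0 - g)%N.
pose J := (#|lang Y N0|).+1; pose N := (J * L * N0)%N.
have F_large : (2 * N0 * (2 * N0 + g) <= F)%N by exact: marker_size_large.
have F0 : (0 < F)%N by apply: leq_trans F_large; nia.
have FE : (F + g = L * N0)%N by rewrite subnK //; nia.
have L2 : (1 < L)%N by rewrite /L; lia.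
have J2 : (1 < J)%N by rewrite ltnS; exact: (lang_gt0 YS _ Yy0).
have m_conflict (t : Z2) : t != 0 -> `|t.1| < N0%:Z -> `|t.2| < N0%:Z ->
    exists v : Z2, [/\ m v <> m (v + t), csquare F v & csquare F (v + t)].
  have sub : csquare (2 * N0 * (2 * N0 + g)) `<=` csquare F.
    by move=> s; rewrite /csquare /box /=; lia.
  move=> t0 t1 t2; have [v [mv v1 v2]] := mP t t0 t1 t2.
  by exists v; split => //; exact: sub.
have data_gap : (#|lang Y N0| < #|data_letters X g n L m|)%N.
  apply: card_data_letters; apply: leq_ltn_trans gap.
  by rewrite leq_add2l leq_exp_base // -mulnn mulnA leq_mul2r /L /N0; lia.
have [enc [dec encP]] := block_coding_exists YS Yy0 (ltnSn _) data_gap.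
have N2 : (1 < N)%N by rewrite /N (leq_trans J2) // -mulnA leq_pmulr // muln_gt0 N0_gt0 ltnW.
pose mk := marker F N.-1 m.
pose dc := block_letter m dec.
have mk_sep x s t : mk x s -> mk x t ->
    `|s.1 - t.1| < N%:Z -> `|s.2 - t.2| < N%:Z -> s = t.
  by move=> ms mt h1 h2; apply: (marker_sep ms mt); [clear - h1|clear - h2]; lia.
exists (block_code H V (y0 0) mk dc); split.
- apply: continuous_subspaceT; apply: fd_continuous => s.
  by apply: block_code_fd; [exact: marker_fd|exact: block_letter_fd].
- apply/seteqP; split => [_ [x Xx <-]|y Yy].
    by apply: adjY; apply: block_code_valid.
  have [x [Xx pre sc]] := encoded_point YS hX Xgl n0 FE F0 L2 J2 Xm m_conflict encP Yy.
  exists x => //.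
  (* Distinct points of the lattice [N Z^2] are at distance at least [N], so all
     occurrences of the marker in [x] are isolated. *)
  have Npos : 0 < N%:Z by rewrite ltz_nat ltnW.
  have mkc c : mk x (scale N%:Z c).
    apply: premarker_marker; first by apply/pre; exists c.
    have close (a b : int) : `|a * N%:Z - b * N%:Z| <= N.-1%:Z -> b = a.
      rewrite -mulrBl => h; suff : a - b = 0 by move=> /eqP; rewrite subr_eq0 => /eqP.
      by apply: (small_multiple Npos); apply: (le_lt_trans h); rewrite ltz_nat prednK // ltnW.
    by move=> t /pre[d ->] /close h1 /close h2; case: (c) (d) h1 h2 => [c1 c2] [d1 d2] /= -> ->.
  have tE : tentative (y0 0) mk dc x = y.
    apply/funext => s; have [c [r ->]] := Z2_divmod s (ltnW N2).
    rewrite (tentative_in _ mk_sep) // /dc /block_letter sc.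
    by have [-> _ _] := encP _ (read_lang YS N (scale N%:Z c) Yy); rewrite ffunE.
  by rewrite block_code_tentative tE //; exact: Yadj.
- by move=> t x _; apply: block_code_sigma; [exact: marker_sigma|exact: block_letter_sigma].
Qed.
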